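(* The Thue-Morse dynamical system, i.e. the action of $\mathbb Z=\langle\sigma\rangle$ on $\Omega$, is minimal but not biminimal.
   Context: $\zeta$ is the endomorphism of $\{0,1\}^*$ given by $0\mapsto01$, $1\mapsto10$. $\Omega\subset\{0,1\}^{\mathbb Z}$ is the set of bi-infinite words all of whose finite subwords occur in $\zeta^n(0)$ for some $n$, with the topology induced from the product topology; $\sigma(w)_n=w_{n+1}$ is the shift. An action of a group $G$ on a topological space $X$ is *minimal* if every $G$-orbit is dense. It is *biminimal* if for all $x,y\in X$ and all open sets $\mathcal U\ni x$, $\mathcal V\ni y$ there exists $g\in G$ with $g(x)\in\mathcal V$ and $g^{-1}(y)\in\mathcal U$. *)

(* Defs.v *)
From HB Require Import structures.
From mathcomp Require Import all_boot all_order all_algebra.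
From mathcomp Require Import all_classical topology.

Set Implicit Arguments.
Unset Strict Implicit.
Unset Printing Implicit Defensive.

Import GRing.Theory.

Local Open Scope classical_set_scope.
Local Open Scope ring_scope.

(* Left actions of a (possibly infinite) group by homeomorphisms; continuity
   of the inverses follows from [act1] and [actM]. *)
Record topAction (G : groupType) (X : topologicalType) := TopAction {
  act :> G -> X -> X;
  act1 : forall x, act 1%g x = x;
  actM : forall g h x, act (g * h)%g x = act g (act h x);
  act_continuous : forall g, continuous (act g)
}.

Definition minimal_action (G : groupType) (X : topologicalType)
  (a : topAction G X) : Prop :=
  forall x : X, dense (range (fun g : G => a g x)).

Definition biminimal_action (G : groupType) (X : topologicalType)
  (a : topAction G X) : Prop :=
  forall (x y : X) (U V : set X), open U -> U x -> open V -> V y ->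
    exists g : G, V (a g x) /\ U (a g^-1%g y).

(* [int] only carries an additive group structure in the library; [intG] is
   the same infinite cyclic group as a [groupType]. *)
Definition intG : Type := int.
HB.instance Definition _ := Choice.on intG.
HB.instance Definition _ := isGroup.Build intG
  (@addrA int) (@add0r int) (@addr0 int) (@addNr int) (@addrN int).

(* The letters 0 and 1 are [false] and [true]. *)
Definition zeta_letter (b : bool) : seq bool :=
  if b then [:: true; false] else [:: false; true].

Definition zeta (s : seq bool) : seq bool := flatten (map zeta_letter s).

Lemma zeta_cat s t : zeta (s ++ t) = zeta s ++ zeta t.
Proof. by rewrite /zeta map_cat flatten_cat. Qed.

Definition biword := prod_topology (fun _ : int => bool).
HB.instance Definition _ := Topological.on biword.

Definition subword (w : biword) (i : int) (n : nat) : seq bool :=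
  [seq w (i + k%:Z) | k <- iota 0 n].

Definition Omega : set biword :=
  [set w | forall (i : int) (n : nat),
     exists m : nat, infix (subword w i n) (iter m zeta [:: false])].

Definition sigma (w : biword) : biword := fun n => w (n + 1).

(* The [k]-th power of [sigma], for [k] of either sign. *)
Definition shift (k : int) (w : biword) : biword := fun n => w (n + k).

Lemma shift1 w : shift 1 w = sigma w.
Proof. by []. Qed.

Lemma shift_continuous (k : int) : continuous (shift k).
Proof.
move=> w; apply/cvg_sup => i U [_ [[B oB <-] Bwi BU]].
apply: (filterS BU).
by apply: (@proj_continuous int (fun=> bool) (i + k) w); exact: open_nbhs_nbhs.
Qed.

Lemma subword_shift k w i n : subword (shift k w) i n = subword w (i + k) n.
Proof. by apply: eq_map => j; rewrite /shift addrAC. Qed.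

Lemma shift_Omega (k : int) (w : Omega) : shift k (val w) \in Omega.
Proof.
by apply/mem_set => i n; rewrite subword_shift; apply: (set_mem (valP w)).
Qed.

(* [Omega], seen as a type, carries the topology induced from [biword]. *)
Definition tm_act (k : intG) (w : Omega) : Omega :=
  exist _ (shift k (val w)) (shift_Omega k w).

Lemma tm_act1 w : tm_act 1%g w = w.
Proof. by apply: val_inj; apply/funext => n; rewrite /= /shift addr0. Qed.

Lemma tm_actM g h w : tm_act (g * h)%g w = tm_act g (tm_act h w).
Proof. by apply: val_inj; apply/funext => n; rewrite /= /shift addrA. Qed.

Lemma tm_act_continuous g : continuous (tm_act g).
Proof.
apply/continuousP => _ [B oB <-].
exists (shift g @^-1` B) => //.
by apply: open_comp => // w _; exact: shift_continuous.
Qed.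

Definition thue_morse_action : topAction intG Omega :=
  TopAction tm_act1 tm_actM tm_act_continuous.

(* [1 : int] is the generator of [intG], not its neutral element. *)
Lemma thue_morse_action_gen (w : Omega) :
  val (thue_morse_action (1 : int) w) = sigma (val w).
Proof. by []. Qed.

(* Main.v *)
(** Let t be the Thue-Morse sequence, so that t(2^m q + r) = t(q) + t(r) mod 2
    for r < 2^m, and the words of Omega are those whose windows all occur in t.

    Minimality: any 2^(m+2) consecutive letters of t contain the prefix of
    length 2^m, hence so does every word of Omega, and every window of a word of
    Omega lies in some prefix of t.

    Failure of biminimality: let x and y be the words with right half t whose
    left halves are the mirror image of t and its complement. They agree exactly
    at the nonnegative positions, and y(-1-i) = 1 - y(i). If a shift by g moved x
    into the cylinder of y on {-1, 0} and the inverse shift moved y into that of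
    x, then x(g-1) = 1, x(g) = 0 and y(g) = y(g-1) = 1. The values at g give
    g < 0, and those at g-1 give g - 1 >= 0. *)

From mathcomp Require Import all_boot all_order all_algebra.
From mathcomp Require Import all_classical topology.
From mathcomp Require Import zify.
Require Import Defs.

Set Implicit Arguments.
Unset Strict Implicit.
Unset Printing Implicit Defensive.

Import GRing.Theory.

Local Open Scope classical_set_scope.
Local Open Scope nat_scope.

Definition tm_word (m : nat) : seq bool := iter m zeta [:: false].

(** Since n < 2 ^ n, the default of [nth] is never returned. *)
Definition tm (n : nat) : bool := nth false (tm_word n) n.

Lemma zeta_negb s : zeta (map negb s) = map negb (zeta s).
Proof. by elim: s => //= -[] s IHs; rewrite /zeta /= -/(zeta _) IHs. Qed.

Lemma size_zeta s : size (zeta s) = (size s).*2.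
Proof. by elim: s => //= -[] s IHs; rewrite /zeta /= -/(zeta _) IHs. Qed.

Lemma nth_zeta s n (b : bool) : n < size s ->
  nth false (zeta s) (n.*2 + b) = b (+) nth false s n.
Proof.
elim: s n => // a s IHs [|n] ltns; first by move=> {ltns IHs}; case: a b => -[].
have := IHs n ltns; rewrite doubleS !addSn /zeta /= -/(zeta _).
by case: a ltns => _ <-.
Qed.

Lemma size_tm_word m : size (tm_word m) = 2 ^ m.
Proof. by elim: m => //= m IHm; rewrite size_zeta IHm expnS mul2n. Qed.

Lemma tm_wordS m : tm_word m.+1 = tm_word m ++ map negb (tm_word m).
Proof.
have tmE k : tm_word k.+1 = zeta (tm_word k) by [].
by elim: m => // m IHm; rewrite tmE {1}IHm zeta_cat zeta_negb -tmE.
Qed.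

Lemma nth_tm_word m n : n < 2 ^ m -> nth false (tm_word m) n = tm n.
Proof.
have stable k p i : i < 2 ^ p ->
    nth false (tm_word (k + p)) i = nth false (tm_word p) i.
  move=> ltip; elim: k => // k <-; rewrite addSn tm_wordS nth_cat size_tm_word.
  by rewrite (leq_trans ltip) // leq_exp2l // leq_addl.
(* Both words are prefixes of [tm_word (n + m)]. *)
move=> ltnm; rewrite /tm -(stable n m) // addnC stable //.
exact: ltn_expl.
Qed.

Lemma tm_word_mkseq m : tm_word m = mkseq tm (2 ^ m).
Proof.
apply: (@eq_from_nth _ false) => [|i]; first by rewrite size_mkseq size_tm_word.
by rewrite size_tm_word => lti; rewrite nth_tm_word ?nth_mkseq.
Qed.

Lemma tm_double n (b : bool) : tm (n.*2 + b) = b (+) tm n.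
Proof.
have ltn : n < 2 ^ n by exact: ltn_expl.
rewrite -(@nth_tm_word n.+1); last by rewrite expnS; case: b; lia.
by rewrite nth_zeta ?size_tm_word.
Qed.

Lemma tm_half n : tm n = odd n (+) tm n./2.
Proof. by rewrite -{1}(odd_double_half n) addnC tm_double. Qed.

Lemma tm_block m q r : r < 2 ^ m -> tm (2 ^ m * q + r) = tm q (+) tm r.
Proof.
elim: m r => [|m IHm] r.
  by case: r => // _; rewrite mul1n addn0 addbF.
rewrite expnS => ltr.
have -> : 2 * 2 ^ m * q + r = (2 ^ m * q + r./2).*2 + odd r.
  by rewrite -{1}(odd_double_half r); lia.
rewrite tm_double IHm; last lia.
by rewrite [tm r]tm_half addbCA.
Qed.

(** Subtracting r from 2 ^ m - 1 flips its m binary digits, so the parity of the digit sum changes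
    by that of m. *)
Lemma tm_rev m r : r < 2 ^ m -> tm (2 ^ m - r.+1) = odd m (+) tm r.
Proof.
elim: m r => [|m IHm] r; first by case: r.
rewrite expnS => ltr.
have -> : 2 * 2 ^ m - r.+1 = (2 ^ m - (r./2).+1).*2 + ~~ odd r.
  by have := odd_double_half r; case: (odd r); lia.
rewrite tm_double IHm; last lia.
rewrite [tm r]tm_half /=.
by case: (odd r); case: (odd m); case: (tm _).
Qed.

(* One of the two blocks of length [2 ^ m] making up an aligned block of length
   [2 ^ m.+1] is the prefix itself, and the other is its complement. *)
Lemma tm_recurrent k m : exists j, j + 2 ^ m <= 2 ^ m.+2 /\
  forall r, r < 2 ^ m -> tm (k + j + r) = tm r.
Proof.
have : k %% 2 ^ m.+1 < 2 ^ m.+1 by rewrite ltn_mod expn_gt0.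
have := divn_eq k (2 ^ m.+1).
move: (k %/ _) (k %% _) => q0 s; rewrite !expnS => eqk lts.
(* The first aligned block of length 2 ^ m.+1 after [k] ends by k + 2 ^ m.+2; its half number [tm q]
   is uncomplemented. *)
pose q := q0.+1.
exists (2 ^ m * (q.*2 + tm q) - k); split.
  by rewrite /q; case: (tm _); lia.
move=> r ltr.
have -> : k + (2 ^ m * (q.*2 + tm q) - k) = 2 ^ m * (q.*2 + tm q).
  by rewrite /q; case: (tm _); lia.
by rewrite tm_block // tm_double addbb.
Qed.

Lemma OmegaP (w : biword) : Omega w <-> forall (i : int) (n : nat),
  exists k : nat, forall j, j < n -> w (i + j%:Z)%R = tm (k + j).
Proof.
split=> Ow i n.
- have [m /infixP [s [u eq_m]]] := Ow i n.
  exists (size s) => j ltjn.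
  have szw : size (subword w i n) = n by rewrite size_map size_iota.
  have := congr1 size eq_m; rewrite -/(tm_word m) size_tm_word !size_cat szw.
  move=> sz_m; rewrite -(@nth_tm_word m) /tm_word ?eq_m; last lia.
  rewrite nth_cat ltnNge leq_addr /= addKn nth_cat szw ltjn.
  by rewrite (nth_map 0) ?size_iota // nth_iota.
- have [k eq_w] := Ow i n.
  (* As k + n <= 2 ^ (k + n), this word reaches past the window. *)
  exists (k + n); rewrite -/(tm_word _) tm_word_mkseq.
  have ltkn : k + n <= 2 ^ (k + n) by rewrite ltnW // ltn_expl.
  have -> : subword w i n = [seq tm j | j <- iota k n].
    rewrite -[in iota k n](addn0 k) iotaDl -map_comp.
    by apply/eq_in_map => j; rewrite mem_iota => /= /eq_w.
  apply/infixP; exists (mkseq tm k).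
  exists [seq tm j | j <- iota (k + n) (2 ^ (k + n) - (k + n))].
  rewrite /mkseq -!map_cat; congr map.
  by rewrite -{1}(subnKC ltkn) !iotaD !add0n -catA.
Qed.

Lemma Omega_tm_prefix (w : biword) m : Omega w ->
  exists i : int, forall r, r < 2 ^ m -> w (i + r%:Z)%R = tm r.
Proof.
move=> /OmegaP /(_ 0%R (2 ^ m.+2)) [k eq_w].
have [j [lej eq_j]] := tm_recurrent k m.
exists j => r ltr.
have := eq_w (j + r); rewrite add0r addnA eq_j // PoszD; apply.
lia.
Qed.

Lemma orbit_approx (x y : biword) (N : nat) : Omega x -> Omega y ->
  exists g : int, forall i : int, (`|i| <= N)%N -> shift g x i = y i.
Proof.
move=> Ox /OmegaP /(_ (- N%:Z)%R N.*2.+1) [k eq_y].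
have [i eq_x] := @Omega_tm_prefix x (k + N.*2.+1) Ox.
have ltkN := @ltn_expl 2 (k + N.*2.+1) isT.
(* The window of [y] on [-N, N] occurs in [x] from i + k on, so its centre lies at i + k + N. *)
exists (i + k%:Z + N%:Z)%R => l lel.
have [j eqj] : exists j : nat, l = (- N%:Z + j%:Z)%R by exists `|(l + N%:Z)%R|%N; lia.
rewrite eqj eq_y; last lia.
rewrite -eq_x; last lia.
by rewrite /shift; congr x; lia.
Qed.

Lemma biword_cvg (z : nat -> biword) (y : biword) :
  (forall N i, (`|i| <= N)%N -> z N i = y i) -> z @ \oo --> y.
Proof.
move=> eq_z; apply/cvg_sup => i U [_ [[B oB <-] Byi BU]].
exists `|i|%N => // N /= leiN; apply: BU; rewrite /= eq_z //.
Qed.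

Lemma thue_morse_minimal : minimal_action thue_morse_action.
Proof.
move=> x O [y Oy] [B oB eqO]; subst O.
have Ox := set_mem (valP x); have Oy' := set_mem (valP y).
have [g eq_g] := choice (fun N => orbit_approx N Ox Oy').
have /(_ B) := @biword_cvg (fun N => shift (g N) (val x)) (val y) eq_g.
case=> [|N _ /(_ N (leqnn N)) BN]; first exact: open_nbhs_nbhs.
by exists (tm_act (g N) x); split => //; exists (g N).
Qed.

(** [Negz n] is -1 - n, the mirror image of n. The words x and y are the cases [c = false] and
    [c = true]. *)
Definition tm_mirror (c : bool) : biword := fun i =>
  match i with Posz n => tm n | Negz n => c (+) tm n end.

Lemma tm_mirror_opp c (i : int) :
  tm_mirror c (- 1 - i)%R = c (+) tm_mirror c i.
Proof.
case: i => n.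
  by have -> : (-1 - n%:Z)%R = Negz n by lia.
have -> : (- 1 - Negz n)%R = n by lia.
by rewrite /= addKb.
Qed.

(* On [-2^m, 2^m[ with m even, the word is the concatenation of two blocks,
   found at [5 * 2^m] in [tm] (tm 5 = tm 6 = 0) for [c = false] and at
   [2 * 2^m] (tm 2 = 1, tm 3 = 0) for [c = true]. *)
Lemma tm_mirror_Omega c : Omega (tm_mirror c).
Proof.
apply/OmegaP => i n.
(* Doubling makes [m] even, so [tm_rev] reverses without complementing. *)
pose m := (`|i|%N + n).*2.
have [q [tmq tmq1]] : exists q, tm q = c /\ tm q.+1 = false.
  by case: c; [exists 2 | exists 5].
have ltm : (`|i|%N + n) < 2 ^ m.
  by apply: leq_trans (@ltn_expl 2 _ isT) _; rewrite leq_exp2l // /m; lia.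
exists `|(Posz (2 ^ m * q.+1) + i)%R|%N => j ltj.
have le_q : 2 ^ m <= 2 ^ m * q.+1 by rewrite leq_pmulr.
case eql: (i + j%:Z)%R => [l|l] /=.
  have -> : `|(Posz (2 ^ m * q.+1) + i)%R|%N + j = 2 ^ m * q.+1 + l by lia.
  by rewrite tm_block ?tmq1 //; lia.
have ltl : l < 2 ^ m by lia.
have -> : `|(Posz (2 ^ m * q.+1) + i)%R|%N + j = 2 ^ m * q + (2 ^ m - l.+1).
  by rewrite mulnS in le_q *; lia.
by rewrite tm_block ?tm_rev ?tmq ?odd_double //; lia.
Qed.

Lemma open_letter (i : int) (b : bool) :
  open [set w : Omega | val w i = b].
Proof.
exists [set w : biword | w i = b] => //.
apply: (@open_comp biword bool (fun w => w i) [set b]); last exact: discrete_open.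
by move=> w _; exact: (@proj_continuous int (fun=> bool) i w).
Qed.

Lemma thue_morse_not_biminimal : ~ biminimal_action thue_morse_action.
Proof.
pose pt c : Omega := exist _ (tm_mirror c) (mem_set (@tm_mirror_Omega c)).
pose cyl (w : biword) : set Omega :=
  [set v | val v (-1)%R = w (-1)%R] `&` [set v | val v 0%R = w 0%R].
have o_cyl w : open (cyl w) by apply: openI; exact: open_letter.
move=> /(_ (pt false) (pt true) (cyl (tm_mirror false)) (cyl (tm_mirror true))).
case=> // g [[xg1 xg0] [yg1 yg0]].
have {}xg1 : tm_mirror false (- 1 + g)%R = true by [].
have {}xg0 : tm_mirror false (0 + g)%R = false by [].
have {}yg1 : tm_mirror true (- 1 - g)%R = false by [].
have {}yg0 : tm_mirror true (0 - g)%R = false by [].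
move: yg1; rewrite tm_mirror_opp => /negbFE y_g.
(* The mirror image of -g is g - 1. *)
have eq_g : (0 - g = - 1 - (- 1 + g))%R by rewrite opprD addNKr sub0r.
move: yg0; rewrite eq_g tm_mirror_opp => /negbFE y_g1.
have g_lt0 : (g < 0)%R.
  by move: xg0 y_g; rewrite add0r; case: (g) => // n /= ->.
by move: xg1 y_g1; case eqh: (- 1 + g)%R => [h|h] /=; [lia | move=> ->].
Qed.

Theorem theorem3 :
  minimal_action thue_morse_action /\ ~ biminimal_action thue_morse_action.
Proof. exact: (conj thue_morse_minimal thue_morse_not_biminimal). Qed.
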